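(* Define the discrete free energy $$F^{n}=\sum_{i=1}^N\mathrm{m}(V_i)\left\{\frac12\rho^n_i\psi^n_i+\sum_{\ell=0}^Mc^{\ell,n}_i\left[\log(a_\ell^3c^{\ell,n}_i)-1\right]+\sum_{\ell=1}^M\frac{\chi(z^\ell)^2}{a_\ell}c^{\ell,n}_i\left(\frac1{\varepsilon_i}-1\right)\right\}+\frac12\sum_{i}\sum_{\sigma\in\mathcal{E}_i\cap\mathcal{E}^{\rm N}_{ext}}\mathrm{m}(\sigma)\psi^{\rm N}_\sigma\psi^n_i-\frac{\kappa}{2}\sum_{i}\sum_{\sigma\in\mathcal{E}_i\cap\mathcal{E}^{\rm D}_{ext}}\tau_\sigma\varepsilon_\sigma\psi^{\rm D}_\sigma D\psi^n_{i,\sigma},$$ where $\rho^n_i=\sum_{\ell=1}^Mz^\ell c^{\ell,n}_i+\rho^f_i$ and $c^{0,n}_i=a_0^{-3}\left(1-\sum_{k=1}^Ma_k^3c^{k,n}_i\right)$. Let $\Delta t>0$ be arbitrary. (1) The solution to Scheme I satisfies, for every $n\ge 0$, $$F^{n+1}-F^n\le-\Delta t\sum_{\ell=1}^M\sum_{\sigma\in\mathcal{E}_{int}}\tau_\sigma\gamma_\ell\,\tilde c^{\ell,n}_\sigma\left|D_\sigma\mu^{\ell,n+1}\right|^2\le0.$$ (2) The solution to Scheme II satisfies, for every $n\ge0$, $$F^{n+1}-F^n\le-\Delta t\sum_{\ell=1}^M\sum_{\sigma\in\mathcal{E}_{int}}\tau_\sigma\gamma_\ell\,\check c^{\ell,n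+\frac12}_\sigma\left|D_\sigma\mu^{\ell,n+\frac12}\right|^2\le0.$$
   Context: Mesh: $\Omega\subset\mathbb{R}^d$ ($d=2,3$) is a bounded polygonal/polyhedral domain, $\partial\Omega=\Gamma_{\rm D}\cup\Gamma_{\rm N}$ (disjoint union). $\mathbf{x}_1,\dots,\mathbf{x}_N$ are the vertices of a Delaunay mesh (triangles/tetrahedra), and $V_i=\{\mathbf{y}\in\Omega: |\mathbf{x}_i-\mathbf{y}|<|\mathbf{x}_j-\mathbf{y}|\ \forall j\ne i\}$ are the dual Voronoi control volumes. $\mathrm{m}(\cdot)$ is Lebesgue measure in $\mathbb{R}^d$ or $\mathbb{R}^{d-1}$. Edges (faces): interior ones $\mathcal{E}_{int}$ are $\sigma=\partial V_i\cap\partial V_j$; exterior ones are $\mathcal{E}^{\rm D}_{ext}$ ($\sigma=\partial V_i\cap\Gamma_{\rm D}$), assumed nonempty so that the discrete Poisson matrix is symmetric positive definite, and $\mathcal{E}^{\rm N}_{ext}$ ($\sigma=\partial V_i\cap\Gamma_{\rm N}$). $\mathcal{E}_i$ is the set of edges of $V_i$. $d_\sigma=|\mathbf{x}_i-\mathbf{x}_j|$ for $\sigma=\partial V_i\cap\partial V_j$ interior, $d_\sigma=\mathrm{dist}(\mathbf{x}_i,\sigma)$ for $\sigma\in\mathcal{E}_i$ exterior, and there is $\xi>0$ with $\mathrm{dist}(\mathbf{x}_i,\sigma)\ge\xi\,\mathrm{diam}(V_i)$ for all $\sigma\in\mathcal{E}_i$. $\tau_\sigma=\mathrm{m}(\sigma)/d_\sigma$.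 For interior $\sigma=\partial V_i\cap\partial V_j$, $Du_{i,\sigma}=u_j-u_i$ and $D_\sigma u=|u_j-u_i|$. Parameters: real valences $z^\ell$, sizes $a_\ell>0$ ($\ell=1,\dots,M$), solvent size $a_0>0$, $\kappa,\chi,\gamma_\ell>0$, dielectric values $\varepsilon_i,\varepsilon_\sigma\in[\varepsilon_{\min},\varepsilon_{\max}]$ with $\varepsilon_{\min}>0$, fixed charges $\rho^f_i\in\mathbb{R}$ (time independent), time step $\Delta t>0$. Write $S^n_i=1-\sum_{k=1}^M a_k^3c^{k,n}_i$. Boundary data (time independent): $\psi^{\rm D}_\sigma$, $\psi^{\rm N}_\sigma\in\mathbb{R}$; $D\psi_{i,\sigma}=\psi^{\rm D}_\sigma-\psi_i$ for $\sigma\in\mathcal{E}_i\cap\mathcal{E}^{\rm D}_{ext}$, and $\kappa\varepsilon_\sigma D\psi_{i,\sigma}/d_\sigma=\psi^{\rm N}_\sigma$ for $\sigma\in\mathcal{E}_i\cap\mathcal{E}^{\rm N}_{ext}$. Zero-flux condition: on every exterior edge, the product (mobility)$\times D\mu^\ell_{i,\sigma}$ appearing in the schemes is $0$. Nodal chemical potential: $\mu^{\ell,n}_i=z^\ell\psi^n_i+\log(a_\ell^3c^{\ell,n}_i)-\frac{a_\ell^3}{a_0^3}\log S^n_i+\frac{\chi(z^\ell)^2}{a_\ell}\left(\frac1{\varepsilon_i}-1\right)$. Discrete Poisson equation: $-\kappa\sum_{\sigma\in\mathcal{E}_i}\tau_\sigma\varepsilon_\sigma D\psi^{n}_{i,\sigma}=\mathrm{m}(V_i)\left(\sum_{\ell=1}^M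 z^\ell c^{\ell,n}_i+\rho^f_i\right)$ for all $i$; it holds at every step $n\ge0$. Scheme I: discrete Poisson equation at step $n+1$ together with $$\mathrm{m}(V_i)\frac{c^{\ell,n+1}_i-c^{\ell,n}_i}{\Delta t}=\gamma_\ell\sum_{\sigma\in\mathcal{E}_i}\tau_\sigma\tilde c^{\ell,n}_\sigma D\mu^{\ell,n+1}_{i,\sigma},\quad \ell=1,\dots,M,\ i=1,\dots,N,$$ with $\mu^{\ell,n+1}_i$ the nodal chemical potential at step $n+1$. The mobility is $\tilde c^{\ell,n}_\sigma=c^{\ell,n}_{i\to j}$ if $D\mu^{\ell,n}_{i,\sigma}<0$ and $c^{\ell,n}_{j\to i}$ if $D\mu^{\ell,n}_{i,\sigma}\ge0$. Scheme II: discrete Poisson equation at step $n+1$ together with $$\mathrm{m}(V_i)\frac{c^{\ell,n+1}_i-c^{\ell,n}_i}{\Delta t}=\gamma_\ell\sum_{\sigma\in\mathcal{E}_i}\tau_\sigma\check c^{\ell,n+\frac12}_\sigma D\mu^{\ell,n+\frac12}_{i,\sigma},$$ $$\mu^{\ell,n+\frac12}_i=\mu^{\ell,n+\frac12}_{e1,i}+\mu^{\ell,n+\frac12}_{e2,i}+\frac{z^\ell}{2}(\psi^n_i+\psi^{n+1}_i)+\frac{\chi(z^\ell)^2}{a_\ell}\left(\frac1{\varepsilon_i}-1\right),$$ $$\mu^{\ell,n+\frac12}_{e1,i}=\log(a_\ell^3c^{\ell,n+1}_i)-\frac{c^{\ell,n+1}_i-c^{\ell,n}_i}{2c^{\ell,n+1}_i}-\frac{(c^{\ell,n+1}_i-c^{\ell,n}_i)^2}{6(c^{\ell,n+1}_i)^2},$$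 $$\mu^{\ell,n+\frac12}_{e2,i}=-\frac{a_\ell^3}{a_0^3}\log S^{n+1}_i-\frac{a_\ell^3\sum_{k=1}^M a_k^3(c^{k,n+1}_i-c^{k,n}_i)}{2a_0^3S^{n+1}_i}+\frac{a_\ell^3\left[\sum_{k=1}^M a_k^3(c^{k,n+1}_i-c^{k,n}_i)\right]^2}{6a_0^3(S^{n+1}_i)^2}.$$ The mobility is $\check c^{\ell,n+\frac12}_\sigma=\hat c^{\ell,n+\frac12}_{i\to j}$ if $D\mu^{\ell,n}_{i,\sigma}<0$ and $\hat c^{\ell,n+\frac12}_{j\to i}$ if $D\mu^{\ell,n}_{i,\sigma}\ge0$, where $\hat c^{\ell,n+\frac12}_i=\frac12(3c^{\ell,n}_i-c^{\ell,n-1}_i)$ if $3c^{\ell,n}_i>c^{\ell,n-1}_i$ and $\hat c^{\ell,n+\frac12}_i=(c^{\ell,n}_i)^{3/2}/(c^{\ell,n-1}_i)^{1/2}$ otherwise; at $n=0$ an arbitrary real array $c^{\ell,-1}_i$ is prescribed for this extrapolation. The initial concentrations satisfy $c^{\ell,0}_i>0$ for all $i$ and $\ell=0,1,\dots,M$, and ''the solution'' of a scheme means the numerical solution with $c^{\ell,n}_i>0$ for all $n\ge0$, all $i$ and $\ell=0,\dots,M$. For each interior edge $\sigma=\partial V_i\cap\partial V_j$ the mobility is a single number attached to $\sigma$ (a fixed ordering $(i,j)$ of the two volumes is used in its definition). Multislope reconstruction $u\mapsto u_{i\to j}$ (used for $u=c^{\ell,n}$ or $u=\hat c^{\ell,n+\frac12}$):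 choose the neighbour $\mathbf{x}_{k_1}$ of $\mathbf{x}_i$ (vertex whose Voronoi cell touches $V_i$) maximizing the cosine of the angle between $\overrightarrow{\mathbf{x}_q\mathbf{x}_i}$ and $\overrightarrow{\mathbf{x}_i\mathbf{x}_j}$ over neighbours $\mathbf{x}_q$; for $r=0,1,2,\dots$ let $\mathbf{x}^{\rm ext}_{ij}=\frac{(2^r+1)\mathbf{x}_i-\mathbf{x}_j}{2^r}$ and take the first $r$ for which it lies in a Delaunay triangle (tetrahedron) having $\mathbf{x}_{k_1}\mathbf{x}_i$ as an edge; let $u^{\rm ext}_{ij}$ be the interpolated value there from the vertex values. Put $s^+_{ij}=\frac{u_j-u_i}{|\mathbf{x}_i\mathbf{x}_j|}$, $s^-_{ij}=\frac{u_i-u^{\rm ext}_{ij}}{|\mathbf{x}_i\mathbf{x}^{\rm ext}_{ij}|}$ and $u_{i\to j}=u_i+\frac{|\mathbf{x}_i\mathbf{x}_j|}2\,\mathrm{minmod}\left(\beta s^+_{ij},\beta s^-_{ij},\frac{s^+_{ij}+s^-_{ij}}2\right)$ with fixed $\beta\in[1,2]$; $\mathrm{minmod}(q_1,q_2,q_3)=k\min_r|q_r|$ if all $q_r$ have the same sign $k$, and $0$ otherwise. $u_{j\to i}$ is defined by exchanging $i$ and $j$. *)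

(* Defs.v *)
From HB Require Import structures.
From mathcomp Require Import all_boot all_order all_algebra.
From mathcomp Require Import all_classical all_reals all_analysis.

Set Implicit Arguments.
Unset Strict Implicit.
Unset Printing Implicit Defensive.

Import Order.TTheory GRing.Theory Num.Theory.
Import numFieldNormedType.Exports.

Local Open Scope classical_set_scope.
Local Open Scope ring_scope.

Section Euclid.
Context {R : realType} {d : nat}.
Implicit Types (x y : 'rV[R]_d) (A : set 'rV[R]_d).

Definition dot x y : R := \sum_(k < d) x 0 k * y 0 k.

(* The norm that the library puts on row vectors is the max norm; it induces
   the same topology, but distances have to be Euclidean. *)
Definition eunorm x : R := Num.sqrt (dot x x).
Definition eudist x y : R := eunorm (x - y).
Definition eudist_set x A : R := inf [set eudist x y | y in A].
Definition eudiam A : R := sup [set eudist p.1 p.2 | p in A `*` A].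

Definition frontier A : set 'rV[R]_d := closure A `\` A°.

(* Barycentric coordinates [lam] of [y] with respect to the points [p k] with
   [k \in T]. *)
Definition barycentric (I : finType) (p : I -> 'rV[R]_d) (T : {set I})
    (lam : I -> R) y : Prop :=
  [/\ forall k, 0 <= lam k, forall k, k \notin T -> lam k = 0,
      \sum_k lam k = 1 & y = \sum_k lam k *: p k].

Definition hull (I : finType) (p : I -> 'rV[R]_d) (T : {set I}) :
    set 'rV[R]_d :=
  [set y | exists lam, barycentric p T lam y].

Definition affinely_independent (I : finType) (p : I -> 'rV[R]_d)
    (T : {set I}) : Prop :=
  forall lam : I -> R, (forall k, k \notin T -> lam k = 0) ->
    \sum_k lam k = 0 -> \sum_k lam k *: p k = 0 -> forall k, lam k = 0.

(* A polygon (d = 2) or polyhedron (d = 3): the boundary is a finite union of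
   nondegenerate segments, respectively triangles. *)
Definition polyhedral_domain A : Prop :=
  [/\ open A, connected A, A !=set0,
      exists r, forall x, A x -> eunorm x <= r
    & exists (m : nat) (p : 'I_m -> 'I_d -> 'rV[R]_d),
        (forall k, affinely_independent (p k) [set: 'I_d]) /\
        frontier A = \bigcup_(k in [set: 'I_m]) hull (p k) [set: 'I_d]%SET].

(* Volume of the unit ball of R^n: omega_n = (2 pi / n) omega_(n-2). *)
Fixpoint unit_ball_volume (n : nat) : R :=
  match n with
  | 0%N => 1
  | 1%N => 2
  | k.+2 => 2 * pi / k.+2%:R * unit_ball_volume k
  end.

(* The s-dimensional Hausdorff measure, normalized so as to agree with the
   Lebesgue measure of R^s on subsets of s-dimensional affine subspaces. *)
Definition hausdorff_content (s : nat) (delta : R) A : \bar R :=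
  ereal_inf
    [set (\sum_(0 <= k <oo)
            (unit_ball_volume s / 2 ^+ s * eudiam (U k) ^+ s)%:E)%E
    | U in [set U : nat -> set 'rV[R]_d |
              (forall k x y, U k x -> U k y -> eudist x y <= delta) /\
              A `<=` \bigcup_k U k]].

Definition hausdorff_measure (s : nat) A : \bar R :=
  ereal_sup [set hausdorff_content s delta A | delta in [set e : R | 0 < e]].

End Euclid.

(* Lebesgue measure of R^d, as iterated product measure: the measure of [A] is
   the integral over the first coordinate of the measures of the sections. *)
Fixpoint lebesgue_rV {R : realType} (d : nat) : set 'rV[R]_d -> \bar R :=
  match d return set 'rV[R]_d -> \bar R with
  | 0%N => fun A => (\1_A 0)%:E
  | d'.+1 => fun A =>
      (\int[@lebesgue_measure R]_t
         lebesgue_rV [set y : 'rV[R]_d' | A (row_mx (t%:M : 'rV[R]_1) y)])%E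
  end.

(* Faces of the control volumes: an interior face is designated by an ordered
   pair of cells, an exterior one by its cell and by its type (Dirichlet or
   Neumann). *)
Definition face (N : nat) := (('I_N * 'I_N) + ('I_N + 'I_N))%type.
Notation IntFace p := (inl p) (only parsing).
Notation DirFace i := (inr (inl i)) (only parsing).
Notation NeuFace i := (inr (inr i)) (only parsing).

Section MeshOperations.
Context {R : realType} {d N : nat}.
Variables (Omega : set 'rV[R]_d) (x : 'I_N -> 'rV[R]_d).

Definition voronoi (i : 'I_N) : set 'rV[R]_d :=
  [set y | Omega y /\ forall j, j != i -> eudist (x i) y < eudist (x j) y].

(* A Delaunay mesh with vertices [x], each element being given by the set of
   the indices of its vertices: nondegenerate simplices, any two of which meet
   exactly along their common (possibly empty) face, with empty open
   circumballs. *)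
Definition delaunay_mesh (elements : {set {set 'I_N}}) : Prop :=
  [/\ forall T, T \in elements -> #|T| = d.+1 /\ affinely_independent x T,
      forall T1 T2, T1 \in elements -> T2 \in elements ->
        hull x T1 `&` hull x T2 = hull x (T1 :&: T2),
      forall i, exists2 T, T \in elements & i \in T
    & forall T, T \in elements -> exists (center : 'rV[R]_d) (r : R),
        (forall i, i \in T -> eudist (x i) center = r) /\
        (forall j, r <= eudist (x j) center)].

Variables GammaD GammaN : set 'rV[R]_d.

Definition face_set (s : face N) : set 'rV[R]_d :=
  match s with
  | IntFace p => frontier (voronoi p.1) `&` frontier (voronoi p.2)
  | DirFace i => frontier (voronoi i) `&` GammaD
  | NeuFace i => frontier (voronoi i) `&` GammaN
  end.

(* m(sigma) and m(V_i) *)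
Definition face_area (s : face N) : R :=
  fine (hausdorff_measure d.-1 (face_set s)).
Definition volume (i : 'I_N) : R := fine (lebesgue_rV (voronoi i)).

(* d_sigma *)
Definition face_dist (s : face N) : R :=
  match s with
  | IntFace p => eudist (x p.1) (x p.2)
  | DirFace i | NeuFace i => eudist_set (x i) (face_set s)
  end.

Definition is_int (s : face N) := if s is IntFace _ then true else false.
Definition is_dir (s : face N) := if s is DirFace _ then true else false.
Definition is_neu (s : face N) := if s is NeuFace _ then true else false.

Definition face_of (i : 'I_N) (s : face N) : bool :=
  match s with
  | IntFace p => (i == p.1) || (i == p.2)
  | DirFace k | NeuFace k => i == k
  end.

(* [orient] fixes, for each pair of distinct cells, the order (i, j) in which
   their common face is listed. Only intersections of positive (d-1)-measure
   are faces. *)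
Variable orient : rel 'I_N.

Definition faces : {set face N} :=
  [set s | (0 < face_area s) &&
           (if s is IntFace p then orient p.1 p.2 else true)].
Definition Eint : {set face N} := [set s in faces | is_int s].
Definition EextD : {set face N} := [set s in faces | is_dir s].
Definition EextN : {set face N} := [set s in faces | is_neu s].
Definition Ecell (i : 'I_N) : {set face N} := [set s in faces | face_of i s].

End MeshOperations.

(* The admissible meshes. By [mesh_regular], no vertex lies on an exterior
   face of its own cell, so that the union of the Delaunay elements cannot be
   required to be all of the closure of [Omega]. *)
Record fv_mesh (R : realType) (d N : nat) := FVMesh {
  Omega : set 'rV[R]_d;
  GammaD : set 'rV[R]_d;
  GammaN : set 'rV[R]_d;
  vertex : 'I_N -> 'rV[R]_d;
  elements : {set {set 'I_N}};
  orient : rel 'I_N;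
  mesh_domain : polyhedral_domain Omega;
  mesh_boundary : frontier Omega = GammaD `|` GammaN;
  mesh_boundary_disj : GammaD `&` GammaN = set0;
  mesh_vertex_inj : injective vertex;
  mesh_vertex_in : forall i, closure Omega (vertex i);
  mesh_delaunay : delaunay_mesh vertex elements;
  mesh_orient_irr : forall i, ~~ orient i i;
  mesh_orient_tot : forall i j, i != j -> orient i j = ~~ orient j i;
  mesh_dirichlet : EextD Omega vertex GammaD GammaN orient != finset.set0;
  mesh_regular : exists2 xi : R, 0 < xi &
    forall i s, s \in Ecell Omega vertex GammaD GammaN orient i ->
      xi * eudiam (voronoi Omega vertex i)
        <= eudist_set (vertex i) (face_set Omega vertex GammaD GammaN s)
}.

Section Mesh.
Context {R : realType} {d N : nat} (Th : fv_mesh R d N).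

Definition cell (i : 'I_N) := voronoi (Omega Th) (vertex Th) i.
Definition mV (i : 'I_N) : R := volume (Omega Th) (vertex Th) i.
Definition mF (s : face N) : R :=
  face_area (Omega Th) (vertex Th) (GammaD Th) (GammaN Th) s.
Definition dF (s : face N) : R :=
  face_dist (Omega Th) (vertex Th) (GammaD Th) (GammaN Th) s.
Definition tau (s : face N) : R := mF s / dF s.
Definition mesh_Eint : {set face N} :=
  Eint (Omega Th) (vertex Th) (GammaD Th) (GammaN Th) (orient Th).
Definition mesh_EextD : {set face N} :=
  EextD (Omega Th) (vertex Th) (GammaD Th) (GammaN Th) (orient Th).
Definition mesh_EextN : {set face N} :=
  EextN (Omega Th) (vertex Th) (GammaD Th) (GammaN Th) (orient Th).
Definition mesh_Ecell (i : 'I_N) : {set face N} :=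
  Ecell (Omega Th) (vertex Th) (GammaD Th) (GammaN Th) (orient Th) i.

(* D u_{i,sigma} and D_sigma u across the interior face p = (k, j) *)
Definition Dint (u : 'I_N -> R) (i : 'I_N) (p : 'I_N * 'I_N) : R :=
  (if i == p.1 then u p.2 else u p.1) - u i.
Definition Dabs (u : 'I_N -> R) (p : 'I_N * 'I_N) : R := `|u p.2 - u p.1|.

Definition minmod (q1 q2 q3 : R) : R :=
  if (Num.sg q1 == Num.sg q2) && (Num.sg q2 == Num.sg q3)
  then Num.sg q1 * Num.min `|q1| (Num.min `|q2| `|q3|) else 0.

Definition neighbour (i q : 'I_N) : Prop :=
  q != i /\ closure (cell i) `&` closure (cell q) !=set0.

(* Cosine of the angle between x_q x_i and x_i x_j *)
Definition cos_angle (i j q : 'I_N) : R :=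
  let v := vertex Th i - vertex Th q in
  let w := vertex Th j - vertex Th i in
  dot v w / (eunorm v * eunorm w).

Definition upstream_neighbour (i j k : 'I_N) : Prop :=
  neighbour i k /\ forall q, neighbour i q -> cos_angle i j q <= cos_angle i j k.

Definition xext (i j : 'I_N) (r : nat) : 'rV[R]_d :=
  (2 ^+ r)^-1 *: ((2 ^+ r + 1) *: vertex Th i - vertex Th j).

(* [lam] are the barycentric coordinates of [xext i j r] in an element that
   has the edge between [i] and [k]. *)
Definition located (i j k : 'I_N) (r : nat) (lam : 'I_N -> R) : Prop :=
  exists2 T, (T \in elements Th) && (k \in T) && (i \in T) &
    barycentric (vertex Th) T lam (xext i j r).

(* The backward slope s^-_ij. When no r is suitable (which happens next to the
   boundary of the mesh) the reconstruction procedure does not prescribe any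
   extrapolated value, and the slope is left arbitrary; in particular slope 0,
   that is u_{i -> j} = u_i, is allowed then. *)
Definition backward_slope (u : 'I_N -> R) (i j : 'I_N) (s : R) : Prop :=
  exists2 k, upstream_neighbour i j k &
    (exists r lam,
       [/\ located i j k r lam,
           forall r' lam', (r' < r)%N -> ~ located i j k r' lam'
         & s = (u i - \sum_v lam v * u v) / eudist (vertex Th i) (xext i j r)])
    \/ (forall r lam, ~ located i j k r lam).

(* [v] is a value of the reconstruction u_{i -> j}. *)
Definition multislope (beta : R) (u : 'I_N -> R) (i j : 'I_N) (v : R) : Prop :=
  let h := eudist (vertex Th i) (vertex Th j) in
  let sp := (u j - u i) / h in
  exists2 sm, backward_slope u i j sm &
    v = u i + h / 2 * minmod (beta * sp) (beta * sm) ((sp + sm) / 2).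

(* [mob] is the mobility on the interior faces upwinded with the sign of
   D mu_{i,sigma}, from the nodal values u. *)
Definition upwind_mobility (beta : R) (u mu : 'I_N -> R)
    (mob : 'I_N * 'I_N -> R) : Prop :=
  forall p, IntFace p \in mesh_Eint ->
    if mu p.2 - mu p.1 < 0 then multislope beta u p.1 p.2 (mob p)
    else multislope beta u p.2 p.1 (mob p).

(* (mobility) x D mu_{i,sigma}, with zero flux on the exterior faces *)
Definition species_flux (mob : 'I_N * 'I_N -> R) (mu : 'I_N -> R)
    (i : 'I_N) (s : face N) : R :=
  match s with
  | IntFace p => mob p * Dint mu i p
  | DirFace _ | NeuFace _ => 0
  end.

End Mesh.

Record pnp_data (R : realType) (d N M : nat) (Th : fv_mesh R d N) := PNPData {
  valence : 'I_M -> R;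
  size_ion : 'I_M -> R;
  size_solvent : R;
  gamma : 'I_M -> R;
  kappa : R;
  chi : R;
  beta : R;
  eps_min : R;
  eps_max : R;
  epsV : 'I_N -> R;
  epsF : face N -> R;
  rhof : 'I_N -> R;
  (* psi^D and psi^N on the exterior faces of each cell *)
  psiD : 'I_N -> R;
  psiN : 'I_N -> R;
  size_ion_gt0 : forall l, 0 < size_ion l;
  size_solvent_gt0 : 0 < size_solvent;
  gamma_gt0 : forall l, 0 < gamma l;
  kappa_gt0 : 0 < kappa;
  chi_gt0 : 0 < chi;
  beta_range : 1 <= beta <= 2;
  eps_min_gt0 : 0 < eps_min;
  epsV_range : forall i, eps_min <= epsV i <= eps_max;
  epsF_range : forall i s, s \in mesh_Ecell Th i -> eps_min <= epsF s <= eps_max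
}.

Section Schemes.
Context {R : realType} {d N M : nat} {Th : fv_mesh R d N}.
Variable P : pnp_data M Th.

Local Notation a := (size_ion P).
Local Notation a0 := (size_solvent P).
Local Notation z := (valence P).

Local Notation conc := ('I_M -> 'I_N -> R).
Local Notation pot := ('I_N -> R).

(* S_i, the volume fraction of the solvent *)
Definition solvent_frac (c : conc) (i : 'I_N) : R :=
  1 - \sum_(k < M) a k ^+ 3 * c k i.
Definition c0 (c : conc) (i : 'I_N) : R := (a0 ^+ 3)^-1 * solvent_frac c i.
Definition rho (c : conc) (i : 'I_N) : R := \sum_(l < M) z l * c l i + rhof P i.

Definition born (l : 'I_M) (i : 'I_N) : R :=
  chi P * z l ^+ 2 / a l * ((epsV P i)^-1 - 1).

(* D psi_{i,sigma}; on a Neumann face it is the solution of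
   kappa eps_sigma D psi_{i,sigma} / d_sigma = psi^N_sigma. *)
Definition Dpsi (psi : pot) (i : 'I_N) (s : face N) : R :=
  match s with
  | IntFace p => Dint psi i p
  | DirFace k => psiD P k - psi i
  | NeuFace k => psiN P k * dF Th s / (kappa P * epsF P s)
  end.

Definition poisson (c : conc) (psi : pot) : Prop :=
  forall i, - kappa P * \sum_(s in mesh_Ecell Th i)
                          tau Th s * epsF P s * Dpsi psi i s
            = mV Th i * rho c i.

Definition mu_nodal (c : conc) (psi : pot) (l : 'I_M) (i : 'I_N) : R :=
  z l * psi i + ln (a l ^+ 3 * c l i) - a l ^+ 3 / a0 ^+ 3 * ln (solvent_frac c i)
  + born l i.

Definition positive_conc (c : nat -> conc) : Prop :=
  forall n i, 0 < c0 (c n) i /\ forall l, 0 < c n l i.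

Definition mass_balance (dt : R) (c c' : conc)
    (mob : 'I_M -> 'I_N * 'I_N -> R) (mu : 'I_M -> 'I_N -> R) : Prop :=
  forall l i,
    mV Th i * ((c' l i - c l i) / dt)
    = gamma P l * \sum_(s in mesh_Ecell Th i)
                    tau Th s * species_flux (mob l) (mu l) i s.

Definition solution_schemeI (dt : R) (c : nat -> conc) (psi : nat -> pot)
    (mob : nat -> 'I_M -> 'I_N * 'I_N -> R) : Prop :=
  [/\ positive_conc c,
      forall n, poisson (c n) (psi n),
      forall n l, upwind_mobility Th (beta P) (c n l)
                    (mu_nodal (c n) (psi n) l) (mob n l)
    & forall n, mass_balance dt (c n) (c n.+1) (mob n)
                  (mu_nodal (c n.+1) (psi n.+1))].

(* The time level n - 1, where [cm1] is prescribed for n = 0 *)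
Definition prev (cm1 : conc) (c : nat -> conc) (n : nat) : conc :=
  if n is k.+1 then c k else cm1.

(* Extrapolation at level n + 1/2, with c and cp at levels n and n - 1 *)
Definition chat (cp c : conc) (l : 'I_M) (i : 'I_N) : R :=
  if 3 * c l i > cp l i then (3 * c l i - cp l i) / 2
  else (c l i `^ (3 / 2)) / (cp l i `^ (1 / 2)).

(* mu_{e1}, mu_{e2} and mu at level n + 1/2, with c and c' the concentrations
   at levels n and n + 1 *)
Definition mu_e1 (c c' : conc) (l : 'I_M) (i : 'I_N) : R :=
  ln (a l ^+ 3 * c' l i) - (c' l i - c l i) / (2 * c' l i)
  - (c' l i - c l i) ^+ 2 / (6 * c' l i ^+ 2).

Definition mu_e2 (c c' : conc) (l : 'I_M) (i : 'I_N) : R :=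
  let V := \sum_(k < M) a k ^+ 3 * (c' k i - c k i) in
  - (a l ^+ 3 / a0 ^+ 3) * ln (solvent_frac c' i)
  - a l ^+ 3 * V / (2 * a0 ^+ 3 * solvent_frac c' i)
  + a l ^+ 3 * V ^+ 2 / (6 * a0 ^+ 3 * solvent_frac c' i ^+ 2).

Definition mu_half (c c' : conc) (psi psi' : pot) (l : 'I_M) (i : 'I_N) : R :=
  mu_e1 c c' l i + mu_e2 c c' l i + z l / 2 * (psi i + psi' i) + born l i.

Definition solution_schemeII (dt : R) (cm1 : conc) (c : nat -> conc)
    (psi : nat -> pot) (mob : nat -> 'I_M -> 'I_N * 'I_N -> R) : Prop :=
  [/\ positive_conc c,
      forall n, poisson (c n) (psi n),
      forall n l, upwind_mobility Th (beta P) (chat (prev cm1 c n) (c n) l)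
                    (mu_nodal (c n) (psi n) l) (mob n l)
    & forall n, mass_balance dt (c n) (c n.+1) (mob n)
                  (mu_half (c n) (c n.+1) (psi n) (psi n.+1))].

Definition free_energy (c : conc) (psi : pot) : R :=
  \sum_(i < N) mV Th i *
    (1 / 2 * rho c i * psi i
     + (c0 c i * (ln (a0 ^+ 3 * c0 c i) - 1)
        + \sum_(l < M) c l i * (ln (a l ^+ 3 * c l i) - 1))
     + \sum_(l < M) chi P * z l ^+ 2 / a l * c l i * ((epsV P i)^-1 - 1))
  + 1 / 2 * \sum_(i < N) \sum_(s in mesh_Ecell Th i :&: mesh_EextN Th)
              mF Th s * psiN P i * psi i
  - kappa P / 2 * \sum_(i < N) \sum_(s in mesh_Ecell Th i :&: mesh_EextD Th)
              tau Th s * epsF P s * psiD P i * Dpsi psi i s.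

Definition dissipation (mob : 'I_M -> 'I_N * 'I_N -> R)
    (mu : 'I_M -> 'I_N -> R) : R :=
  \sum_(l < M) \sum_(p | IntFace p \in mesh_Eint Th)
    tau Th (IntFace p) * gamma P l * mob l p * Dabs (mu l) p ^+ 2.

End Schemes.

(* Main.v *)
Require Import Defs.
From mathcomp Require Import all_boot all_order all_algebra.
From mathcomp Require Import all_classical all_reals all_analysis.
From mathcomp Require Import ring lra.

Import Order.TTheory GRing.Theory Num.Theory.
Import numFieldNormedType.Exports.

(** The scheme is a gradient flow: testing the mass balance of each species
    with its own chemical potential and summing by parts over the faces turns
    the fluxes into minus the dissipation.  The zero flux condition removes the
    exterior faces, and the dissipation is nonnegative because the limited
    slopes keep the reconstructed mobilities nonnegative
    ([upwind_mobility_ge0]).  Since the volumes are nonnegative, it remains to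
    bound the free energy increment by this same tested sum.  The free energy
    splits into two parts that are treated separately.

    - Field energy.  By the discrete Poisson equation it equals, up to a
      constant, half of a nonnegative symmetric form Q evaluated at
      (psi, psi), and testing a variation of the charge with a potential v
      gives the form of the variation of psi and v.  Hence the increment is
      exactly the work of the charge variation against the midpoint potential
      ([field_energy_midpoint]), and at most its work against the new
      potential ([field_energy_implicit]).  Neumann faces enter the weak form
      only through their data, and these terms cancel against the boundary
      term of the free energy provided that d_sigma > 0; the latter comes
      from mesh regularity ([dF_Neumann_gt0]).

    - Chemical energy.  It is local and is a sum of functions x (ln (a x) - 1)
      of the ion and solvent concentrations, plus a linear term.  The first
      scheme evaluates the derivative at the new time, so convexity suffices.
      The second uses the Taylor polynomial of order three around the new
      value, whose remainder has a sign because the fourth derivative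
      2 / x ^ 3 of the entropy is positive ([entropy_le_order3]).

    [free_energy_step] assembles these facts for any potential of the form
    z phi + nu, which covers both schemes. *)

Set Implicit Arguments.
Unset Strict Implicit.
Unset Printing Implicit Defensive.
Local Open Scope ring_scope.

(** * Taylor bounds for the entropy *)

(** The sign condition says that the intermediate point lies on the same side
    of [s] as [t]; it covers both orders of [s] and [t] at once and lets the
    lemma be iterated. *)
Lemma MVT_pos (R : realType) (f df : R -> R) (s t : R) : 0 < s -> 0 < t ->
  (forall x : R, 0 < x -> is_derive x 1 f (df x)) ->
  exists c, [/\ 0 < c, 0 <= (c - s) * (t - s) & f t - f s = df c * (t - s)].
Proof.
move=> s0 t0 df_f.
have mvt u v : 0 < u -> u <= v ->
    exists2 c, c \in `[u, v] & f v - f u = df c * (v - u).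
  move=> u0 uv; apply: MVT_segment => // [x|].
    by rewrite in_itv /= => /andP[ux _]; apply: df_f; apply: lt_trans ux.
  apply: continuous_in_subspaceT => x; rewrite inE /= in_itv /= => /andP[ux _].
  apply: differentiable_continuous; apply/derivable1_diffP.
  by have [] := df_f x (lt_le_trans u0 ux).
have [st|/ltW ts] := leP s t.
  have [c /[!in_itv]/= /andP[sc ct] e] := mvt _ _ s0 st.
  by exists c; split=> //; [exact: lt_le_trans sc | rewrite mulr_ge0 ?subr_ge0].
have [c /[!in_itv]/= /andP[tc cs] e] := mvt _ _ t0 ts.
exists c; split; first exact: lt_le_trans tc.
  by rewrite mulr_le0 ?subr_le0.
by rewrite -opprB e -mulrN opprB.
Qed.

(** The left-hand side is the Taylor polynomial of [t * ln t] at 1.  The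
    difference has vanishing value and first derivative at 1, and second
    derivative [(x - 1) ^+ 2 / x], so two uses of the mean value theorem
    suffice. *)
Lemma xlnx_ge_taylor3 (R : realType) (t : R) : 0 < t ->
  (t - 1) + (t - 1) ^+ 2 / 2 - (t - 1) ^+ 3 / 6 <= t * ln t.
Proof.
move=> t0.
pose h (x : R) := x * ln x - (x - 1) - (x - 1) ^+ 2 / 2 + (x - 1) ^+ 3 / 6.
pose dh (x : R) := ln x - (x - 1) + (x - 1) ^+ 2 / 2.
pose d2h (x : R) := (x - 1) ^+ 2 / x.
have dhP (x : R) : 0 < x -> is_derive x 1 h (dh x).
  move=> x0; have dl := is_derive1_ln x0.
  apply: is_derive_eq.
  rewrite /dh /GRing.scale /=; field.
  by rewrite gt_eqF.
have d2hP (x : R) : 0 < x -> is_derive x 1 dh (d2h x).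
  move=> x0; have dl := is_derive1_ln x0.
  apply: is_derive_eq.
  rewrite /d2h /GRing.scale /=; field.
  by rewrite gt_eqF.
have [c [c0 ct hE]] := MVT_pos ltr01 t0 dhP.
have [e [e0 _ dhE]] := MVT_pos ltr01 c0 d2hP.
suff: 0 <= h t by rewrite /h; lra.
have h1 : h 1 = 0 by rewrite /h ln1; field.
have dh1 : dh 1 = 0 by rewrite /dh ln1; field.
rewrite h1 subr0 in hE; rewrite dh1 subr0 in dhE.
rewrite hE dhE -mulrA mulr_ge0 // /d2h divr_ge0 ?sqr_ge0 // ltW //.
Qed.

(** The inequality is homogeneous: with [t = y / x] it is
    [xlnx_ge_taylor3] multiplied by [x]. *)
Lemma entropy_le_order3 (R : realType) (a x y : R) : 0 < a -> 0 < x -> 0 < y ->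
  x * (ln (a * x) - 1) - y * (ln (a * y) - 1) <=
  (x - y) * (ln (a * x) - (x - y) / (2 * x) - (x - y) ^+ 2 / (6 * x ^+ 2)).
Proof.
move=> a0 x0 y0.
have /xlnx_ge_taylor3 : 0 < y / x by rewrite divr_gt0.
rewrite -(ler_pM2l x0) -subr_ge0 => le.
rewrite -subr_ge0; apply: le_trans le _.
rewrite ln_div ?posrE // !lnM ?posrE // le_eqVlt; apply/orP; left; apply/eqP.
by field; rewrite gt_eqF.
Qed.

(** Convexity of the entropy, that is, [ln u <= u - 1] at [u = x / y]. *)
Lemma entropy_le_order1 (R : realType) (a x y : R) : 0 < a -> 0 < x -> 0 < y ->
  x * (ln (a * x) - 1) - y * (ln (a * y) - 1) <= (x - y) * ln (a * x).
Proof.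
move=> a0 x0 y0.
have : ln (1 + (x / y - 1)) <= x / y - 1.
  by apply: le_ln1Dx; rewrite ltrBDl subrr divr_gt0.
rewrite addrC subrK ln_div ?posrE // -(ler_pM2l y0) => le.
rewrite !lnM ?posrE //.
have yxy : y * (x / y - 1) = x - y by field; rewrite gt_eqF.
rewrite yxy in le; lra.
Qed.

(** * Volumes, distances and transmissibilities of the mesh *)

Lemma lebesgue_rV_ge0 (R : realType) (d : nat) (A : set 'rV[R]_d) :
  (0 <= lebesgue_rV A)%E.
Proof.
elim: d A => [|d IHd] A /=; last by apply: integral_ge0 => t _; exact: IHd.
by rewrite lee_fin indicE ler0n.
Qed.

Lemma mV_ge0 (R : realType) (d N : nat) (Th : fv_mesh R d N) i : 0 <= mV Th i.
Proof. exact/fine_ge0/lebesgue_rV_ge0. Qed.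

Lemma dot_ge0 (R : realType) (d : nat) (x : 'rV[R]_d) : 0 <= dot x x.
Proof. by apply: sumr_ge0 => k _; rewrite -expr2 sqr_ge0. Qed.

Lemma eudist_ge0 (R : realType) (d : nat) (x y : 'rV[R]_d) : 0 <= eudist x y.
Proof. exact: sqrtr_ge0. Qed.

Lemma eudist_eq0 (R : realType) (d : nat) (x y : 'rV[R]_d) :
  eudist x y = 0 -> x = y.
Proof.
move/eqP; rewrite /eudist /eunorm sqrtr_eq0 => le0.
have /eqP : dot (x - y) (x - y) = 0 by apply: le_anti; rewrite le0 dot_ge0.
rewrite psumr_eq0 => [/allP eq0|k _]; last by rewrite -expr2 sqr_ge0.
apply/rowP => k; move: (eq0 k (mem_index_enum k)).
by rewrite /= !mxE -expr2 sqrf_eq0 subr_eq0 => /eqP.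
Qed.

Lemma eudistxx (R : realType) (d : nat) (x : 'rV[R]_d) : eudist x x = 0.
Proof.
rewrite /eudist /eunorm subrr /dot big1 ?sqrtr0 // => k _.
by rewrite mxE mul0r.
Qed.

Lemma eudist_le (R : realType) (d : nat) (r : R) (x y : 'rV[R]_d) :
  eunorm x <= r -> eunorm y <= r -> eudist x y <= 2 * r.
Proof.
move=> xr yr.
have r0 : 0 <= r by apply: le_trans xr; exact: sqrtr_ge0.
have sqr_le (v : 'rV[R]_d) : eunorm v <= r -> dot v v <= r ^+ 2.
  by move=> vr; rewrite -(sqr_sqrtr (dot_ge0 v)) lerXn2r ?nnegrE ?sqrtr_ge0.
rewrite -(ler_pXn2r (isT : (0 < 2)%N)) ?nnegrE ?eudist_ge0 ?mulr_ge0 //.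
rewrite sqr_sqrtr ?dot_ge0 //.
have le : dot (x - y) (x - y) <= 2 * dot x x + 2 * dot y y.
  rewrite /dot !mulr_sumr -big_split; apply: ler_sum => k _ /=; rewrite !mxE.
  by have := sqr_ge0 (x 0 k + y 0 k); lra.
by apply: le_trans le _; have := sqr_le _ xr; have := sqr_le _ yr; nra.
Qed.

(** Boundedness is essential: the supremum of an unbounded set of reals is 0
    by convention. *)
Lemma eudiam_le0_subset1 (R : realType) (d : nat) (r : R) (A : set 'rV[R]_d) :
  (forall x, A x -> eunorm x <= r) -> eudiam A <= 0 -> is_subset1 A.
Proof.
move=> Ar diam0 x y Ax Ay; apply: eudist_eq0; apply: le_anti.
rewrite eudist_ge0 andbT; apply: le_trans diam0; apply: ub_le_sup.
  by exists (2 * r) => _ [[u v] [/= Au Av] <-]; apply: eudist_le; exact: Ar.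
by exists (x, y).
Qed.

Lemma eudiam_subset1 (R : realType) (d : nat) (A : set 'rV[R]_d) :
  is_subset1 A -> eudiam A = 0.
Proof.
move=> A1.
have sub : ([set eudist p.1 p.2 | p in A `*` A] `<=` [set 0])%classic.
  by move=> _ [[u v] [/= Au Av] <-]; rewrite (A1 _ _ Au Av) eudistxx.
rewrite /eudiam.
by have [->|->] := subset_set1 sub; rewrite ?sup0 ?sup1.
Qed.

(** Covering [A] by copies of itself costs nothing, as they have diameter 0. *)
Lemma hausdorff_measure_subset1 (R : realType) (d s : nat) (A : set 'rV[R]_d) :
  (0 < s)%N -> is_subset1 A -> (hausdorff_measure s A <= 0)%E.
Proof.
move=> s0 A1; apply: ge_ereal_sup => _ [delta /= delta0 <-].
apply: ereal_inf_lbound; exists (fun=> A) => /=.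
  split; last by move=> x Ax; exists 0%N.
  by move=> _ x y Ax Ay; rewrite (A1 _ _ Ax Ay) eudistxx ltW.
by apply: eseries0 => k _ _; rewrite eudiam_subset1 // expr0n gtn_eqF //= mulr0.
Qed.

Lemma closure_subset1 (R : realType) (d : nat) (A : set 'rV[R]_d) :
  is_subset1 A -> is_subset1 (closure A).
Proof.
case: d A => [|d] A A1 x y clx cly; first by rewrite (thinmx0 x) (thinmx0 y).
have [a Aa] : (A !=set0)%classic.
  by have [a [Aa _]] := clx _ (filterT : nbhs x setT); exists a.
have sub : (A `<=` [set a])%classic by move=> b Ab; exact: A1.
have cl1 : closed [set a]%classic.
  apply: accessible_closed_set1; apply: hausdorff_accessible.
  exact: (@norm_hausdorff _ 'rV[R]_d.+1).
have clE z : closure A z -> z = a.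
  by move=> /(closureS sub); rewrite -(closure_id _).1.
by rewrite (clE _ clx) (clE _ cly).
Qed.

(** By regularity a vanishing distance would force the cell to have diameter
    0, hence to have at most one point.  Its frontier would then have at most
    one point as well, and the face would have no area. *)
Lemma dF_Neumann_gt0 (R : realType) (d N : nat) (Th : fv_mesh R d N) i :
  (1 < d)%N -> NeuFace i \in mesh_Ecell Th i -> 0 < dF Th (NeuFace i).
Proof.
move=> d1 si; have [xi xi0 reg] := mesh_regular Th.
apply: lt_le_trans (reg _ _ si); rewrite pmulr_rgt0 // ltNge.
apply/negP => diam0.
have [_ _ _ [r Or] _] := mesh_domain Th.
have cell1 : is_subset1 (cell Th i).
  by apply: (eudiam_le0_subset1 (r := r)) diam0 => x [Ox _]; exact: Or.
have face1 : is_subset1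
    (face_set (Omega Th) (vertex Th) (GammaD Th) (GammaN Th) (NeuFace i)).
  move=> x y [[clx _] _] [[cly _] _].
  exact: closure_subset1 cell1 _ _ clx cly.
move: si; rewrite !inE => /andP[/andP[+ _] _]; apply/negP; rewrite -leNgt.
apply: (@fine_le0 R); apply: hausdorff_measure_subset1 => //.
by rewrite -ltnS prednK // ltnW.
Qed.

Lemma tau_ge0 (R : realType) (d N : nat) (Th : fv_mesh R d N) i s :
  s \in mesh_Ecell Th i -> 0 <= tau Th s.
Proof.
rewrite !inE => /andP[/andP[mF0 _] _]; apply: divr_ge0; first exact: ltW.
have setge0 (x : 'rV[R]_d) A : 0 <= eudist_set x A.
  rewrite /eudist_set; set E := image _ _.
  have [->|/set0P E0] := eqVneq E set0.
    by rewrite inf0.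
  by apply: lb_le_inf => // _ [y _ <-]; exact: eudist_ge0.
by case: s {mF0} => [p|[k|k]] /=; [exact: eudist_ge0 | exact: setge0..].
Qed.

(** * Nonnegativity of the mobilities *)

(** Only a negative limited slope could be harmful.  All three slopes are then
    negative and the limited one is at least [b * sp] with [b <= 2], so that
    half a step of it goes no lower than [u j]. *)
Lemma multislope_ge0 (R : realType) (d N : nat) (Th : fv_mesh R d N) (b : R)
    u i j v : 1 <= b <= 2 -> 0 <= u i -> 0 <= u j ->
  multislope Th b u i j v -> 0 <= v.
Proof.
move=> /andP[b1 b2] ui uj [sm _ ->].
set h := eudist _ _; set sp := (u j - u i) / h.
rewrite /minmod; case: ifP => [|_]; last by rewrite mulr0 addr0.
set m := Num.min _ _ => _.
have b0 : 0 < b by lra.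
have h0 : 0 <= h by exact: eudist_ge0.
have m0 : 0 <= m by rewrite !le_min !normr_ge0.
have mle : m <= b * `|sp| by rewrite /m ge_min normrM gtr0_norm // lexx.
rewrite sgrM gtr0_sg // mul1r.
have [sp0|sp0|->] := ltrgtP sp 0; last 2 first.
- by rewrite gtr0_sg // mul1r addr_ge0 // mulr_ge0 // divr_ge0.
- by rewrite sgr0 mul0r mulr0 addr0.
rewrite ltr0_sg // mulN1r mulrN subr_ge0.
have hsp : h * sp = u j - u i.
  rewrite /sp mulrCA mulfV ?mulr1 //.
  by apply/eqP => h_eq0; move: sp0; rewrite /sp h_eq0 invr0 mulr0 ltxx.
rewrite ltr0_norm // in mle.
have m_le : m <= 2 * - sp by nra.
by have := ler_wpM2l h0 m_le; lra.
Qed.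

Lemma chat_ge0 (R : realType) (N M : nat) (cp c : 'I_M -> 'I_N -> R) l i :
  0 <= chat cp c l i.
Proof.
rewrite /chat; case: ifP => [gt|_]; last by rewrite divr_ge0 ?powR_ge0.
by rewrite divr_ge0 // subr_ge0 ltW.
Qed.

Lemma upwind_mobility_ge0 (R : realType) (d N : nat) (Th : fv_mesh R d N)
    (b : R) u mu mob p : 1 <= b <= 2 -> (forall i, 0 <= u i) ->
  upwind_mobility Th b u mu mob -> IntFace p \in mesh_Eint Th -> 0 <= mob p.
Proof.
move=> b12 u0 up pint; have := up p pint.
by case: ifP => _; apply: multislope_ge0.
Qed.

(** * Summation by parts and the discrete Poisson equation *)

Lemma Eint_neq (R : realType) (d N : nat) (Th : fv_mesh R d N) p :
  IntFace p \in mesh_Eint Th -> p.1 != p.2.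
Proof.
rewrite !inE => /andP[/andP[_ or12] _]; apply: contraL or12 => /eqP ->.
exact: mesh_orient_irr.
Qed.

Lemma Eint_Ecell (R : realType) (d N : nat) (Th : fv_mesh R d N) p :
  IntFace p \in mesh_Eint Th -> IntFace p \in mesh_Ecell Th p.1.
Proof. by rewrite !inE /= eqxx /= !andbT. Qed.

(** Summation by parts rests on this regrouping: an interior face is visited
    once from each of its two cells, which are distinct, and an exterior face
    once. *)
Lemma sum_Ecell_split (R : realType) (d N : nat) (Th : fv_mesh R d N)
    (H : 'I_N -> face N -> R) :
  \sum_i \sum_(s in mesh_Ecell Th i) H i s =
    \sum_(p | IntFace p \in mesh_Eint Th)
       (H p.1 (IntFace p) + H p.2 (IntFace p))
    + \sum_i \sum_(s in mesh_Ecell Th i :&: mesh_EextD Th) H i s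
    + \sum_i \sum_(s in mesh_Ecell Th i :&: mesh_EextN Th) H i s.
Proof.
have split3 i : \sum_(s in mesh_Ecell Th i) H i s =
    \sum_(s in mesh_Ecell Th i :&: mesh_Eint Th) H i s
    + \sum_(s in mesh_Ecell Th i :&: mesh_EextD Th) H i s
    + \sum_(s in mesh_Ecell Th i :&: mesh_EextN Th) H i s.
  rewrite (bigID (fun s => is_int s)) /= -addrA; congr (_ + _).
    apply: eq_bigl => -[p|[k|k]]; rewrite !inE /= ?andbF //.
    by case: (_ < _) (orient _ _ _) => -[] //=; rewrite ?andbT.
  rewrite (bigID (fun s => is_dir s)) /=; congr (_ + _); apply: eq_bigl.
    move=> -[p|[k|k]]; rewrite !inE /= ?andbF ?andbT //.
    by case: (_ < _) => //=; rewrite andbT.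
  move=> -[p|[k|k]]; rewrite !inE /= ?andbF ?andbT //.
  by case: (_ < _) => //=; rewrite andbT.
rewrite (eq_bigr _ (fun i _ => split3 i)) !big_split /=.
congr (_ + _ + _).
rewrite (exchange_big_dep (fun s => s \in mesh_Eint Th)) /=; last first.
  by move=> i s _; rewrite finset.in_setI => /andP[].
rewrite big_sumType /= [X in _ + X]big1 ?addr0; last first.
  by move=> s; rewrite !inE andbF.
rewrite -big_split /=; apply: eq_bigr => p pint; have p12 := Eint_neq pint.
rewrite (bigD1 p.1) /=; last by rewrite finset.in_setI pint andbT Eint_Ecell.
congr (_ + _); rewrite (big_pred1 p.2) // => i.
rewrite finset.in_setI pint andbT /= inE /mesh_Ecell.
have -> : IntFace p \in faces (Omega Th) (vertex Th) (GammaD Th) (GammaN Th)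
    (orient Th) by move: pint; rewrite inE => /andP[].
rewrite /=; have [->|] := eqVneq i p.1; last by rewrite andbT.
by rewrite andbF (negbTE p12).
Qed.

(** The discrete Dirichlet form of the Poisson problem with homogeneous
    boundary data; it is stripped of the factor kappa. *)
Definition poisson_form (R : realType) (d N M : nat) (Th : fv_mesh R d N)
    (P : pnp_data M Th) (u v : 'I_N -> R) : R :=
  \sum_(p | IntFace p \in mesh_Eint Th)
     tau Th (IntFace p) * epsF P (IntFace p)
     * ((u p.2 - u p.1) * (v p.2 - v p.1))
  + \sum_i \sum_(s in mesh_Ecell Th i :&: mesh_EextD Th)
     tau Th s * epsF P s * (u i * v i).

Lemma poisson_formC (R : realType) (d N M : nat) (Th : fv_mesh R d N)
    (P : pnp_data M Th) u v : poisson_form P u v = poisson_form P v u.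
Proof.
congr (_ + _); first by apply: eq_bigr => p _; congr (_ * _); exact: mulrC.
apply: eq_bigr => i _; apply: eq_bigr => s _; congr (_ * _); exact: mulrC.
Qed.

Lemma tau_eps_ge0 (R : realType) (d N M : nat) (Th : fv_mesh R d N)
    (P : pnp_data M Th) i s :
  s \in mesh_Ecell Th i -> 0 <= tau Th s * epsF P s.
Proof.
move=> si; apply: mulr_ge0; first exact: tau_ge0 si.
have /andP[+ _] := epsF_range P si; apply: le_trans.
exact/ltW/eps_min_gt0.
Qed.

(** This is the nonnegativity of the form at [u - v]. *)
Lemma poisson_form_young (R : realType) (d N M : nat) (Th : fv_mesh R d N)
    (P : pnp_data M Th) u v :
  2 * poisson_form P u v <= poisson_form P u u + poisson_form P v v.
Proof.
rewrite /poisson_form mulrDr addrACA -!big_split /= !mulr_sumr.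
apply: lerD; apply: ler_sum.
  move=> p /Eint_Ecell pint; have := tau_eps_ge0 P pint.
  have := sqr_ge0 ((u p.2 - u p.1) - (v p.2 - v p.1)).
  set k := tau _ _ * _; set x := u _ - _; set y := v _ - _; nra.
move=> i _; rewrite -big_split /= mulr_sumr.
apply: ler_sum => s /setIP[/(tau_eps_ge0 P) + _].
have := sqr_ge0 (u i - v i).
by set k := tau _ _ * _; nra.
Qed.

(** The variational form of the Poisson equation.  The two boundary terms do
    not depend on [psi], so they disappear when two time levels are
    subtracted. *)
Lemma poisson_weak (R : realType) (d N M : nat) (Th : fv_mesh R d N)
    (P : pnp_data M Th) c psi v : (1 < d)%N -> poisson P c psi ->
  \sum_i mV Th i * rho P c i * v i =
    kappa P * poisson_form P psi v
    - kappa P * \sum_i \sum_(s in mesh_Ecell Th i :&: mesh_EextD Th)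
                  tau Th s * epsF P s * (psiD P i * v i)
    - \sum_i \sum_(s in mesh_Ecell Th i :&: mesh_EextN Th)
        mF Th s * psiN P i * v i.
Proof.
move=> d1 poi.
have -> : \sum_i mV Th i * rho P c i * v i = - kappa P *
    \sum_i \sum_(s in mesh_Ecell Th i)
       tau Th s * epsF P s * Dpsi P psi i s * v i.
  rewrite mulr_sumr; apply: eq_bigr => i _.
  by rewrite -poi -mulrA mulr_suml.
rewrite sum_Ecell_split mulrDr /poisson_form; congr (_ + _); last first.
  rewrite mulr_sumr -sumrN; apply: eq_bigr => i _.
  rewrite mulr_sumr -sumrN; apply: eq_bigr => -[p|[k|k]] /setIP[si].
  - by rewrite !inE andbF.
  - by rewrite !inE andbF.
  move=> _; have ik : i = k by move: si; rewrite !inE => /andP[_ /eqP].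
  subst k; have dF0 := dF_Neumann_gt0 d1 si.
  have eps0 : 0 < epsF P (NeuFace i).
    by apply: lt_le_trans (eps_min_gt0 P) _; have /andP[] := epsF_range P si.
  (* The two occurrences of the distance to the face, one in tau and one in
     the Neumann condition, cancel only if that distance is nonzero. *)
  rewrite /= /tau; field.
  by rewrite !gt_eqF //; exact: kappa_gt0.
rewrite !mulrDr -addrA; congr (_ + _).
  rewrite !mulr_sumr; apply: eq_bigr => p /Eint_neq p12.
  by rewrite /= /Dint eqxx eq_sym (negbTE p12); ring.
rewrite -mulrBr -sumrB mulNr -mulrN -sumrN; congr (_ * _).
apply: eq_bigr => i _; rewrite -sumrB -sumrN.
apply: eq_bigr => -[p|[k|k]] /setIP[si]; rewrite ?inE ?andbF //= => _.
have ik : i = k by move: si; rewrite !inE => /andP[_ /eqP].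
by subst k; ring.
Qed.

(** * Increment of the field energy *)

Definition field_energy (R : realType) (d N M : nat) (Th : fv_mesh R d N)
    (P : pnp_data M Th) (c : 'I_M -> 'I_N -> R) (psi : 'I_N -> R) : R :=
  1 / 2 * \sum_i mV Th i * rho P c i * psi i
  + 1 / 2 * \sum_i \sum_(s in mesh_Ecell Th i :&: mesh_EextN Th)
              mF Th s * psiN P i * psi i
  - kappa P / 2 * \sum_i \sum_(s in mesh_Ecell Th i :&: mesh_EextD Th)
              tau Th s * epsF P s * psiD P i * Dpsi P psi i s.

(** The test function [psi] in the weak form; the Neumann terms and the mixed
    Dirichlet terms cancel. *)
Lemma field_energyE (R : realType) (d N M : nat) (Th : fv_mesh R d N)
    (P : pnp_data M Th) c psi : (1 < d)%N -> poisson P c psi ->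
  field_energy P c psi = kappa P / 2 * poisson_form P psi psi
    - kappa P / 2 * \sum_i \sum_(s in mesh_Ecell Th i :&: mesh_EextD Th)
                      tau Th s * epsF P s * psiD P i ^+ 2.
Proof.
move=> d1 poi; rewrite /field_energy (poisson_weak _ d1 poi).
have -> : \sum_i \sum_(s in mesh_Ecell Th i :&: mesh_EextD Th)
              tau Th s * epsF P s * psiD P i * Dpsi P psi i s =
    \sum_i \sum_(s in mesh_Ecell Th i :&: mesh_EextD Th)
       tau Th s * epsF P s * psiD P i ^+ 2
    - \sum_i \sum_(s in mesh_Ecell Th i :&: mesh_EextD Th)
       tau Th s * epsF P s * (psiD P i * psi i).
  rewrite -sumrB; apply: eq_bigr => i _; rewrite -sumrB.
  apply: eq_bigr => -[p|[k|k]] /setIP[si]; rewrite ?inE ?andbF //= => _.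
  have ik : i = k by move: si; rewrite !inE => /andP[_ /eqP].
  by subst k; ring.
by field.
Qed.

(** For a symmetric form, Q(psi', psi') - Q(psi, psi) is
    Q(psi' - psi, psi' + psi). *)
Lemma field_energy_midpoint (R : realType) (d N M : nat) (Th : fv_mesh R d N)
    (P : pnp_data M Th) c c' psi psi' :
  (1 < d)%N -> poisson P c psi -> poisson P c' psi' ->
  field_energy P c' psi' - field_energy P c psi =
  \sum_i mV Th i * (rho P c' i - rho P c i) * ((psi i + psi' i) / 2).
Proof.
move=> d1 poi poi'.
have -> : \sum_i mV Th i * (rho P c' i - rho P c i) * ((psi i + psi' i) / 2) =
    (\sum_i mV Th i * rho P c' i * psi i + \sum_i mV Th i * rho P c' i * psi' i
     - \sum_i mV Th i * rho P c i * psi i - \sum_i mV Th i * rho P c i * psi' i)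
    / 2.
  rewrite -big_split -!sumrB mulr_suml; apply: eq_bigr => i _ /=.
  by field.
rewrite (field_energyE d1 poi) (field_energyE d1 poi').
rewrite !(poisson_weak _ d1 poi) !(poisson_weak _ d1 poi').
by rewrite (poisson_formC P psi' psi); field.
Qed.

Lemma field_energy_implicit (R : realType) (d N M : nat) (Th : fv_mesh R d N)
    (P : pnp_data M Th) c c' psi psi' :
  (1 < d)%N -> poisson P c psi -> poisson P c' psi' ->
  field_energy P c' psi' - field_energy P c psi <=
  \sum_i mV Th i * (rho P c' i - rho P c i) * psi' i.
Proof.
move=> d1 poi poi'.
have -> : \sum_i mV Th i * (rho P c' i - rho P c i) * psi' i =
    \sum_i mV Th i * rho P c' i * psi' i - \sum_i mV Th i * rho P c i * psi' i.
  by rewrite -sumrB; apply: eq_bigr => i _; ring.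
rewrite (field_energyE d1 poi) (field_energyE d1 poi').
rewrite !(poisson_weak _ d1 poi) !(poisson_weak _ d1 poi').
have := ler_wpM2l (ltW (kappa_gt0 P)) (poisson_form_young P psi psi'); lra.
Qed.

(** * Increment of the chemical energy *)

Definition chemical_energy (R : realType) (d N M : nat) (Th : fv_mesh R d N)
    (P : pnp_data M Th) (c : 'I_M -> 'I_N -> R) (i : 'I_N) : R :=
  c0 P c i * (ln (size_solvent P ^+ 3 * c0 P c i) - 1)
  + \sum_l c l i * (ln (size_ion P l ^+ 3 * c l i) - 1)
  + \sum_l c l i * born P l i.

Lemma free_energyE (R : realType) (d N M : nat) (Th : fv_mesh R d N)
    (P : pnp_data M Th) c psi :
  free_energy P c psi =
  field_energy P c psi + \sum_i mV Th i * chemical_energy P c i.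
Proof.
rewrite /free_energy /field_energy [RHS]addrAC [X in _ = X - _]addrAC.
congr (_ + _ - _).
rewrite mulr_sumr -big_split /=; apply: eq_bigr => i _.
rewrite /chemical_energy.
have -> : \sum_l chi P * valence P l ^+ 2 / size_ion P l * c l i
            * ((epsV P i)^-1 - 1) = \sum_l c l i * born P l i.
  by apply: eq_bigr => l _; rewrite /born; ring.
by field.
Qed.

(** The solvent fills the volume left by the ions.  This turns the entropy
    variation of the solvent into a contribution to each ionic potential,
    weighted by the volume of the ion. *)
Lemma c0_diff (R : realType) (d N M : nat) (Th : fv_mesh R d N)
    (P : pnp_data M Th) c c' i :
  c0 P c' i - c0 P c i =
  - (\sum_k size_ion P k ^+ 3 * (c' k i - c k i)) / size_solvent P ^+ 3.
Proof.
have -> : \sum_k size_ion P k ^+ 3 * (c' k i - c k i) =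
    \sum_k size_ion P k ^+ 3 * c' k i - \sum_k size_ion P k ^+ 3 * c k i.
  by rewrite -sumrB; apply: eq_bigr => k _; rewrite mulrBr.
by rewrite /c0 /solvent_frac; ring.
Qed.

Lemma solvent_fracE (R : realType) (d N M : nat) (Th : fv_mesh R d N)
    (P : pnp_data M Th) c i :
  solvent_frac P c i = size_solvent P ^+ 3 * c0 P c i.
Proof. by rewrite mulVKf // expf_neq0 // gt_eqF // size_solvent_gt0. Qed.

Lemma chemical_energy_implicit (R : realType) (d N M : nat)
    (Th : fv_mesh R d N) (P : pnp_data M Th) c c' i :
  0 < c0 P c i -> 0 < c0 P c' i ->
  (forall l, 0 < c l i) -> (forall l, 0 < c' l i) ->
  chemical_energy P c' i - chemical_energy P c i <=
  \sum_l (c' l i - c l i) *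
    (ln (size_ion P l ^+ 3 * c' l i)
     - size_ion P l ^+ 3 / size_solvent P ^+ 3 * ln (solvent_frac P c' i)
     + born P l i).
Proof.
move=> c00 c00' cp cp'.
have a00 : 0 < size_solvent P ^+ 3 by rewrite exprn_gt0 // size_solvent_gt0.
have a0 l : 0 < size_ion P l ^+ 3 by rewrite exprn_gt0 // size_ion_gt0.
have solvent := entropy_le_order1 a00 c00' c00.
have ions : \sum_l c' l i * (ln (size_ion P l ^+ 3 * c' l i) - 1)
     - \sum_l c l i * (ln (size_ion P l ^+ 3 * c l i) - 1)
     <= \sum_l (c' l i - c l i) * ln (size_ion P l ^+ 3 * c' l i).
  by rewrite -sumrB; apply: ler_sum => l _; exact: entropy_le_order1.
have -> : \sum_l (c' l i - c l i) *
    (ln (size_ion P l ^+ 3 * c' l i)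
     - size_ion P l ^+ 3 / size_solvent P ^+ 3 * ln (solvent_frac P c' i)
     + born P l i) =
  \sum_l (c' l i - c l i) * ln (size_ion P l ^+ 3 * c' l i)
  + (c0 P c' i - c0 P c i) * ln (solvent_frac P c' i)
  + (\sum_l c' l i * born P l i - \sum_l c l i * born P l i).
  rewrite c0_diff mulNr mulNr !mulr_suml -!sumrN -!big_split /=.
  by apply: eq_bigr => l _; ring.
by rewrite solvent_fracE /chemical_energy; lra.
Qed.

Lemma chemical_energy_midpoint (R : realType) (d N M : nat)
    (Th : fv_mesh R d N) (P : pnp_data M Th) c c' i :
  0 < c0 P c i -> 0 < c0 P c' i ->
  (forall l, 0 < c l i) -> (forall l, 0 < c' l i) ->
  chemical_energy P c' i - chemical_energy P c i <=
  \sum_l (c' l i - c l i) * (mu_e1 P c c' l i + mu_e2 P c c' l i + born P l i).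
Proof.
move=> c00 c00' cp cp'.
have a00 : 0 < size_solvent P ^+ 3 by rewrite exprn_gt0 // size_solvent_gt0.
have a0 l : 0 < size_ion P l ^+ 3 by rewrite exprn_gt0 // size_ion_gt0.
have solvent := entropy_le_order3 a00 c00' c00.
have ions : \sum_l c' l i * (ln (size_ion P l ^+ 3 * c' l i) - 1)
     - \sum_l c l i * (ln (size_ion P l ^+ 3 * c l i) - 1)
     <= \sum_l (c' l i - c l i) * mu_e1 P c c' l i.
  by rewrite -sumrB; apply: ler_sum => l _; exact: entropy_le_order3.
have e2 : \sum_l (c' l i - c l i) * mu_e2 P c c' l i =
    (c0 P c' i - c0 P c i) *
    (ln (size_solvent P ^+ 3 * c0 P c' i)
     - (c0 P c' i - c0 P c i) / (2 * c0 P c' i)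
     - (c0 P c' i - c0 P c i) ^+ 2 / (6 * c0 P c' i ^+ 2)).
  (* Dividing the variation of c0 by the new c0 yields minus the quotient of
     V by the new solvent fraction, which explains the signs in mu_e2. *)
  rewrite /mu_e2 c0_diff solvent_fracE; set V := \sum_k size_ion P k ^+ 3 * _.
  set L := ln _; set x := c0 P c' i.
  rewrite [RHS](_ : _ = V * (- (L / size_solvent P ^+ 3)
      - V / (2 * size_solvent P ^+ 3 * (size_solvent P ^+ 3 * x))
      + V ^+ 2 / (6 * size_solvent P ^+ 3 * (size_solvent P ^+ 3 * x) ^+ 2)));
    last by field; rewrite !gt_eqF // size_solvent_gt0.
  by rewrite /V mulr_suml; apply: eq_bigr => l _; rewrite -/V; ring.
have -> : \sum_l (c' l i - c l i) *
    (mu_e1 P c c' l i + mu_e2 P c c' l i + born P l i) =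
  \sum_l (c' l i - c l i) * mu_e1 P c c' l i
  + \sum_l (c' l i - c l i) * mu_e2 P c c' l i
  + (\sum_l c' l i * born P l i - \sum_l c l i * born P l i).
  by rewrite -sumrB -!big_split /=; apply: eq_bigr => l _; ring.
by rewrite e2 /chemical_energy; lra.
Qed.

(** * Energy dissipation *)

(** On an interior face the two cells see opposite differences of [mu], so
    summation by parts produces minus the square of the jump. *)
Lemma mass_balance_dissipation (R : realType) (d N M : nat)
    (Th : fv_mesh R d N) (P : pnp_data M Th) dt c c' mob mu : dt != 0 ->
  mass_balance P dt c c' mob mu ->
  \sum_i mV Th i * \sum_l (c' l i - c l i) * mu l i
    = - dt * dissipation P mob mu.
Proof.
move=> dt0 mb.
have mbE l i : mV Th i * (c' l i - c l i) = dt * gamma P l *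
    \sum_(s in mesh_Ecell Th i) tau Th s * species_flux (mob l) (mu l) i s.
  by rewrite -[in RHS]mulrA -mb; field.
under eq_bigr do rewrite mulr_sumr.
rewrite exchange_big mulr_sumr; apply: eq_bigr => l _ /=.
have -> : \sum_i mV Th i * ((c' l i - c l i) * mu l i) = dt * gamma P l *
    \sum_i \sum_(s in mesh_Ecell Th i)
       tau Th s * species_flux (mob l) (mu l) i s * mu l i.
  rewrite mulr_sumr; apply: eq_bigr => i _.
  by rewrite mulrA mbE -mulrA mulr_suml.
rewrite sum_Ecell_split [X in _ + X]big1 ?[X in _ + X + _]big1 ?addr0.
- rewrite !mulr_sumr; apply: eq_bigr => p /Eint_neq p12.
  rewrite /= /Dint /Dabs real_normK ?num_real // eqxx eq_sym (negbTE p12).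
  by ring.
- move=> i _; apply: big1 => -[p|k] /setIP[_]; rewrite ?inE ?andbF //= => _.
  by case: k => k; rewrite mulr0 mul0r.
- move=> i _; apply: big1 => -[p|k] /setIP[_]; rewrite ?inE ?andbF //= => _.
  by case: k => k; rewrite mulr0 mul0r.
Qed.

(** The field and the chemical energy may be tested with different parts of
    the potential, because the variation of the charge is the sum of the
    variations of the concentrations weighted by the valences. *)
Lemma free_energy_step (R : realType) (d N M : nat) (Th : fv_mesh R d N)
    (P : pnp_data M Th) dt c c' psi psi' mob
    (phi : 'I_N -> R) (nu mu : 'I_M -> 'I_N -> R) : dt != 0 ->
  (forall l i, mu l i = valence P l * phi i + nu l i) ->
  field_energy P c' psi' - field_energy P c psi <=
    \sum_i mV Th i * (rho P c' i - rho P c i) * phi i ->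
  (forall i, chemical_energy P c' i - chemical_energy P c i <=
             \sum_l (c' l i - c l i) * nu l i) ->
  mass_balance P dt c c' mob mu ->
  free_energy P c' psi' - free_energy P c psi <= - dt * dissipation P mob mu.
Proof.
move=> dt0 muE field_le chem_le mb.
rewrite -(mass_balance_dissipation dt0 mb) !free_energyE.
have chem : \sum_i mV Th i * chemical_energy P c' i
     - \sum_i mV Th i * chemical_energy P c i <=
     \sum_i mV Th i * \sum_l (c' l i - c l i) * nu l i.
  rewrite -sumrB; apply: ler_sum => i _; rewrite -mulrBr.
  exact: ler_wpM2l (mV_ge0 Th i) _ _ (chem_le i).
have -> : \sum_i mV Th i * \sum_l (c' l i - c l i) * mu l i =
    \sum_i mV Th i * (rho P c' i - rho P c i) * phi i
    + \sum_i mV Th i * \sum_l (c' l i - c l i) * nu l i.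
  rewrite -big_split; apply: eq_bigr => i _ /=.
  rewrite -mulrA -mulrDr; congr (_ * _).
  rewrite /rho opprD addrACA subrr addr0 -sumrB mulr_suml -big_split.
  by apply: eq_bigr => l _ /=; rewrite muE; ring.
by lra.
Qed.

Lemma dissipation_ge0 (R : realType) (d N M : nat) (Th : fv_mesh R d N)
    (P : pnp_data M Th) mob mu :
  (forall l p, IntFace p \in mesh_Eint Th -> 0 <= mob l p) ->
  0 <= dissipation P mob mu.
Proof.
move=> mob0; apply: sumr_ge0 => l _; apply: sumr_ge0 => p pint.
apply: mulr_ge0; last exact: sqr_ge0.
apply: mulr_ge0; last exact: mob0.
by apply: mulr_ge0; [exact: tau_ge0 (Eint_Ecell pint) | exact/ltW/gamma_gt0].
Qed.

Unset Implicit Arguments.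

Theorem theorem4p4 (R : realType) (d N M : nat) (hd : d = 2%N \/ d = 3%N)
    (Th : fv_mesh R d N) (P : pnp_data M Th) (dt : R) (hdt : 0 < dt) :
  (forall (c : nat -> 'I_M -> 'I_N -> R) (psi : nat -> 'I_N -> R)
      (mob : nat -> 'I_M -> 'I_N * 'I_N -> R),
    solution_schemeI P dt c psi mob ->
    forall n : nat,
      let D := dissipation P (mob n) (mu_nodal P (c n.+1) (psi n.+1)) in
      free_energy P (c n.+1) (psi n.+1) - free_energy P (c n) (psi n)
        <= - dt * D <= 0)
  /\
  (forall (cm1 : 'I_M -> 'I_N -> R) (c : nat -> 'I_M -> 'I_N -> R)
      (psi : nat -> 'I_N -> R) (mob : nat -> 'I_M -> 'I_N * 'I_N -> R),
    solution_schemeII P dt cm1 c psi mob ->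
    forall n : nat,
      let D := dissipation P (mob n)
                 (mu_half P (c n) (c n.+1) (psi n) (psi n.+1)) in
      free_energy P (c n.+1) (psi n.+1) - free_energy P (c n) (psi n)
        <= - dt * D <= 0).
Proof.
have d1 : (1 < d)%N by case: hd => ->.
have dt0 : dt != 0 by rewrite gt_eqF.
have decay mob mu :
    (forall l p, IntFace p \in mesh_Eint Th -> 0 <= mob l p) ->
    - dt * dissipation P mob mu <= 0.
  by move=> mob0; rewrite mulNr oppr_le0 mulr_ge0 ?(ltW hdt) ?dissipation_ge0.
split=> [c psi mob [pos poi up mb] n|cm1 c psi mob [pos poi up mb] n] /=;
    apply/andP; split.
- apply: free_energy_step dt0 _ (field_energy_implicit d1 (poi n) (poi n.+1))
    (fun i => chemical_energy_implicit (pos n i).1 (pos n.+1 i).1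
                (pos n i).2 (pos n.+1 i).2) (mb n) => l i.
  by rewrite /mu_nodal; ring.
- apply: decay => l p.
  apply: upwind_mobility_ge0 (beta_range P) _ (up n l) => i.
  exact: ltW ((pos n i).2 l).
- apply: (free_energy_step (phi := fun i => (psi n i + psi n.+1 i) / 2) dt0 _ _
    (fun i => chemical_energy_midpoint (pos n i).1 (pos n.+1 i).1
                (pos n i).2 (pos n.+1 i).2) (mb n)) => [l i|].
    by rewrite /mu_half; ring.
  by rewrite (field_energy_midpoint d1 (poi n) (poi n.+1)).
- apply: decay => l p.
  apply: upwind_mobility_ge0 (beta_range P) _ (up n l) => i.
  exact: chat_ge0.
Qed.
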